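(* $\mathrm{UCL}_\mathbb{R}\not\le_W\mathrm{BWT}_\mathbb{R}$, $\mathrm{BWT}_\mathbb{R}\not\le_W\mathrm{UCL}_\mathbb{R}$, $\mathrm{CL}_\mathbb{N}\not\le_W\mathrm{BWT}_\mathbb{R}$ and $\mathrm{BWT}_\mathbb{R}\not\le_W\mathrm{CL}_\mathbb{N}$.
   Context: A representation of a set $X$ is a surjective partial function $\delta:\subseteq\mathbb{N}^\mathbb{N}\to X$. For $f:\subseteq(X,\delta_X)\rightrightarrows(Y,\delta_Y)$ a realizer is a single-valued partial $F$ on Baire space with $\delta_Y(F(p))\in f(\delta_X(p))$ for all $p\in\mathrm{dom}(f\circ\delta_X)$ ($F\vdash f$). With $\langle p,q\rangle(2n)=p(n)$, $\langle p,q\rangle(2n+1)=q(n)$: $f\le_W g$ iff there are computable partial $H,K$ on Baire space such that $p\mapsto H\langle p,G(K(p))\rangle$ realizes $f$ for every $G\vdash g$. $\mathbb{R}$ has the Cauchy representation $\delta(p)=\lim_m\overline{p(m)}$ for $p$ with $|\overline{p(m)}-\overline{p(k)}|<2^{-m}$ ($k>m$), $\overline{i}$ the $i$-th rational; $\mathbb{N}$ is represented by $p\mapsto p(0)$; sequence spaces $X^\mathbb{N}$ by $\langle p_0,p_1,\ldots\rangle\mapsto(\delta_X(p_i))_i$, where $\langle p_0,p_1,\ldots\rangle(\langle i,j\rangle)=p_i(j)$ for a standard pairing. $\mathrm{BWT}_\mathbb{R}$ maps a bounded sequence of reals to any of its cluster points; $\mathrm{UCL}_\mathbb{R}$ maps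 a sequence of reals with exactly one cluster point to that cluster point; $\mathrm{CL}_\mathbb{N}$ maps a sequence of natural numbers in which some number occurs infinitely often to any number that occurs infinitely often in it. *)

(* Defs.v *)
From Stdlib Require Import Reals QArith Qreals Lra Lia Arith Cantor.
From Stdlib Require Import ClassicalEpsilon FunctionalExtensionality.

Open Scope nat_scope.

Definition baire : Type := nat -> nat.

Notation "⟨ a , b ⟩" := (Cantor.to_nat (a, b)) (format "⟨ a ,  b ⟩").

Record pfun (A B : Type) : Type := Pfun {
  graph :> A -> B -> Prop;
  graph_fun : forall a b b', graph a b -> graph a b' -> b = b'
}.
Arguments Pfun {A B} _ _.
Arguments graph {A B} _ _ _.

(** Codes for the unary partial recursive functions with an oracle; tuples are
    passed through the Cantor pairing, so that [cPair cLeft cRight] is the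
    identity. *)
Inductive code : Type :=
  | cZero | cSucc | cLeft | cRight | cOracle
  | cPair (f g : code)
  | cComp (f g : code)
  | cPrec (f g : code)
  | cMu (f : code).

(** [eval p c a b]: the function coded by [c] with oracle [p] is defined at [a]
    with value [b].  In [eval_mu], [v] lists the predecessors of the (nonzero)
    values of [f] at the arguments below the least zero [n]. *)
Inductive eval (p : baire) : code -> nat -> nat -> Prop :=
  | eval_zero a : eval p cZero a 0
  | eval_succ a : eval p cSucc a (S a)
  | eval_left a b : eval p cLeft ⟨a, b⟩ a
  | eval_right a b : eval p cRight ⟨a, b⟩ b
  | eval_oracle a : eval p cOracle a (p a)
  | eval_pair f g a b c :
      eval p f a b -> eval p g a c -> eval p (cPair f g) a ⟨b, c⟩
  | eval_comp f g a b c :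
      eval p g a b -> eval p f b c -> eval p (cComp f g) a c
  | eval_prec0 f g a b :
      eval p f a b -> eval p (cPrec f g) ⟨a, 0⟩ b
  | eval_precS f g a n b c :
      eval p (cPrec f g) ⟨a, n⟩ b -> eval p g ⟨a, ⟨n, b⟩⟩ c ->
      eval p (cPrec f g) ⟨a, S n⟩ c
  | eval_mu f a n (v : nat -> nat) :
      (forall m, m < n -> eval p f ⟨a, m⟩ (S (v m))) ->
      eval p f ⟨a, n⟩ 0 ->
      eval p (cMu f) a n.

(** As usual for Type-2 machines, the behaviour outside the domain of [F] is
    left unconstrained. *)
Definition computable (F : pfun baire baire) : Prop :=
  exists c : code, forall p q, F p q -> forall n, eval p c n (q n).

Record repspace : Type := Repspace {
  carrier :> Type;
  delta : pfun baire carrier;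
  delta_surj : forall x, exists p, delta p x
}.
Arguments Repspace {carrier} _ _.
Arguments delta {_}.

Definition nat_delta : pfun baire nat.
Proof.
  refine (Pfun (fun p n => p 0 = n) _).
  intros; congruence.
Defined.

Lemma nat_delta_surj (n : nat) : exists p, nat_delta p n.
Proof. now exists (fun _ => n). Qed.

Definition nat_space : repspace := Repspace nat_delta nat_delta_surj.

(** The rational with index [⟨⟨a, b⟩, k⟩] is (a - b) / (k + 1). *)
Definition rat (i : nat) : Q :=
  let (u, k) := Cantor.of_nat i in
  let (a, b) := Cantor.of_nat u in
  Qmake (Z.of_nat a - Z.of_nat b) (Pos.of_succ_nat k).

Definition ratR (i : nat) : R := Q2R (rat i).

Definition real_delta : pfun baire R.
Proof.
  refine (Pfun (fun p x =>
    (forall m k, m < k -> (Rabs (ratR (p m) - ratR (p k)) < / 2 ^ m)%R)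
    /\ Un_cv (fun m => ratR (p m)) x) _).
  intros p x y [_ Hx] [_ Hy]; exact (UL_sequence _ _ _ Hx Hy).
Defined.

Lemma ratR_dense (x eps : R) :
  (0 < eps)%R -> exists i, (Rabs (ratR i - x) < eps)%R.
Proof.
  intros He.
  destruct (archimed_cor1 eps He) as [[|N] [HN HN0]]; [lia|].
  set (z := up (x * INR (S N))).
  exists ⟨⟨Z.to_nat z, Z.to_nat (- z)⟩, N⟩.
  unfold ratR, rat; rewrite !Cantor.cancel_of_to.
  replace (Z.of_nat (Z.to_nat z) - Z.of_nat (Z.to_nat (- z)))%Z with z by lia.
  unfold Q2R; cbn [Qnum Qden].
  replace (IZR (Z.pos (Pos.of_succ_nat N))) with (INR (S N))
    by (now rewrite INR_IZR_INZ).
  destruct (archimed (x * INR (S N))) as [H1 H2]; fold z in H1, H2.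
  assert (HS : (0 < INR (S N))%R) by (apply lt_0_INR; lia).
  replace (IZR z * / INR (S N) - x)%R
    with ((IZR z - x * INR (S N)) * / INR (S N))%R by (field; lra).
  assert (HI : (0 < / INR (S N))%R) by now apply Rinv_0_lt_compat.
  rewrite Rabs_pos_eq by (apply Rmult_le_pos; lra).
  apply Rle_lt_trans with (1 * / INR (S N))%R; [|lra].
  apply Rmult_le_compat_r; lra.
Qed.

Lemma real_delta_surj (x : R) : exists p, real_delta p x.
Proof.
  assert (Hp : forall m, (0 < / 2 ^ m)%R)
    by (intros m; apply Rinv_0_lt_compat, pow_lt; lra).
  assert (He : forall m, exists i, (Rabs (ratR i - x) < / 2 ^ m / 2)%R)
    by (intros m; apply ratR_dense; specialize (Hp m); lra).
  pose (p := fun m => proj1_sig (constructive_indefinite_description _ (He m))).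
  assert (H : forall m, (Rabs (ratR (p m) - x) < / 2 ^ m / 2)%R)
    by (intros m; exact (proj2_sig (constructive_indefinite_description _ (He m)))).
  exists p; split.
  - intros m k Hmk.
    assert (Hle : (/ 2 ^ k <= / 2 ^ m)%R).
    { apply Rinv_le_contravar; [apply pow_lt; lra|apply Rle_pow; [lra|lia]]. }
    pose proof (H m) as H1; pose proof (H k) as H2.
    apply Rabs_def2 in H1; apply Rabs_def2 in H2; apply Rabs_def1; lra.
  - intros eps Heps.
    destruct (pow_lt_1_zero (/ 2)) with (y := eps) as [N HN];
      [rewrite Rabs_pos_eq; lra|exact Heps|].
    exists N; intros n Hn; specialize (HN n Hn); unfold Rdist.
    rewrite pow_inv, Rabs_pos_eq in HN by (specialize (Hp n); lra).
    specialize (H n); specialize (Hp n); lra.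
Qed.

Definition real_space : repspace := Repspace real_delta real_delta_surj.

Definition seq_delta (X : repspace) : pfun baire (nat -> X).
Proof.
  refine (Pfun (fun p x => forall i, delta (fun j => p ⟨i, j⟩) (x i)) _).
  intros p x y Hx Hy; apply functional_extensionality; intros i.
  exact (graph_fun _ _ _ _ _ _ (Hx i) (Hy i)).
Defined.

Lemma seq_delta_surj (X : repspace) (x : nat -> X) : exists p, seq_delta X p x.
Proof.
  pose (q := fun i =>
    constructive_indefinite_description _ (delta_surj X (x i))).
  exists (fun n => let (i, j) := Cantor.of_nat n in proj1_sig (q i) j).
  intros i.
  replace (fun j => _) with (proj1_sig (q i)).
  - exact (proj2_sig (q i)).
  - apply functional_extensionality; intros j; now rewrite Cantor.cancel_of_to.
Qed.

Definition seq_space (X : repspace) : repspace :=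
  Repspace (seq_delta X) (seq_delta_surj X).

(** A partial multi-valued function is identified with its graph; its domain is
    the set of points with at least one value. *)
Definition mvfun (X Y : repspace) : Type := X -> Y -> Prop.

Definition dom {X Y : repspace} (f : mvfun X Y) (x : X) : Prop :=
  exists y, f x y.

Definition realizes {X Y : repspace} (F : pfun baire baire) (f : mvfun X Y) :
    Prop :=
  forall p x, delta p x -> dom f x ->
  exists q y, F p q /\ delta q y /\ f x y.

Definition interleave (p q : baire) : baire :=
  fun n => if Nat.even n then p (Nat.div2 n) else q (Nat.div2 n).

(** The partial function p ↦ H⟨p, G(K(p))⟩. *)
Definition weihrauch_comp (H G K : pfun baire baire) : pfun baire baire.
Proof.
  refine (Pfun (fun p r =>
    exists k q, K p k /\ G k q /\ H (interleave p q) r) _).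
  intros p r r' (k & q & Hk & Hq & Hr) (k' & q' & Hk' & Hq' & Hr').
  rewrite (graph_fun _ _ _ _ _ _ Hk' Hk) in Hq'.
  rewrite (graph_fun _ _ _ _ _ _ Hq' Hq) in Hr'.
  exact (graph_fun _ _ _ _ _ _ Hr Hr').
Defined.

Definition weihrauch_le {X Y Z W : repspace} (f : mvfun X Y) (g : mvfun Z W) :
    Prop :=
  exists H K : pfun baire baire,
    computable H /\ computable K /\
    forall G : pfun baire baire,
      realizes G g -> realizes (weihrauch_comp H G K) f.

Notation "f ≤W g" := (weihrauch_le f g) (at level 70, no associativity).

Definition bounded_seq (x : nat -> R) : Prop :=
  exists M : R, forall n, (Rabs (x n) <= M)%R.

(** [ValAdh x y]: [y] is a cluster point of the sequence [x]. *)
Definition BWT_R : mvfun (seq_space real_space) real_space :=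
  fun (x : nat -> R) (y : R) => bounded_seq x /\ ValAdh x y.

Definition UCL_R : mvfun (seq_space real_space) real_space :=
  fun (x : nat -> R) (y : R) => ValAdh x y /\ forall z, ValAdh x z -> z = y.

Definition CL_N : mvfun (seq_space nat_space) nat_space :=
  fun (x : nat -> nat) (n : nat) => forall N, exists k, N <= k /\ x k = n.

Lemma dom_BWT_R (x : nat -> R) : dom BWT_R x <-> bounded_seq x.
Proof.
  split; [now intros [y [Hb _]]|].
  intros [M HM].
  destruct (Bolzano_Weierstrass x (fun c => - M <= c <= M)%R) as [y Hy].
  - apply compact_P3.
  - intros n; specialize (HM n); revert HM.
    unfold Rabs; destruct (Rcase_abs (x n)); lra.
  - exists y; split; [now exists M|exact Hy].
Qed.

(* Main.v *)
Require Import Defs.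
From Stdlib Require Import Reals Lra Lia Arith Cantor Classical ClassicalEpsilon.
From Stdlib Require Import FunctionalExtensionality.

(** Only two properties of computations matter: they are deterministic and each
    value uses a finite part of the oracle.  All four separations are obtained
    by forcing with conditions that consist of a finite sequence of numbers and
    a set to which all later entries are confined.

    - [CL_N] and [UCL_R] against [BWT_R]: in a generic sequence [0] is the only
      recurrent value.  The cluster points of the associated bounded sequence
      form a compact set, so finitely many prefixes of names suffice for the
      answer [0], and a condition forces the bounded sequence to remain in the
      corresponding neighbourhoods.  Continuing with a constant fresh number
      makes this answer wrong.
    - [BWT_R] against [CL_N]: a solution of the inner instance is one of
      countably many numbers, and each of them is defeated by confining the
      sequence to a smaller interval.
    - [BWT_R] against [UCL_R]: for every [N] some condition keeps the inner
      sequence out of [[-N, N]] from some point on, so that a generic inner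
      sequence has no cluster point.  Otherwise inner sequences would return to
      [[-N, N]] below every condition; a generic sequence then determines,
      from a finite prefix, both a neighbourhood that the inner sequence cannot
      leave within [[-N, N]] and an interval that the answer avoids, and
      confining the sequence to this interval gives a wrong answer. *)

Open Scope nat_scope.

Local Opaque Cantor.to_nat.

(** * Finite use of oracle computations *)

Definition agree (l : nat) (p q : baire) : Prop := forall m, m < l -> p m = q m.

Lemma agree_le (l l' : nat) (p q : baire) : l <= l' -> agree l' p q -> agree l p q.
Proof. intros H A m Hm; apply A; lia. Qed.

Lemma uniform_bound (Q : nat -> nat -> Prop) (n : nat) :
  (forall m l l', l <= l' -> Q m l -> Q m l') ->
  (forall m, m < n -> exists l, Q m l) -> exists l, forall m, m < n -> Q m l.
Proof.
  intros Hmon; induction n as [|n IH]; intros H.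
  - exists 0; lia.
  - destruct IH as [l Hl]; [intros m Hm; apply H; lia|].
    destruct (H n) as [l' Hl']; [lia|].
    exists (max l l'); intros m Hm.
    destruct (Nat.eq_dec m n) as [->|Hne].
    + apply Hmon with l'; [lia|exact Hl'].
    + apply Hmon with l; [lia|apply Hl; lia].
Qed.

Lemma eval_det (p : baire) (c : code) (a b b' : nat) :
  eval p c a b -> eval p c a b' -> b = b'.
Proof.
  intros H; revert b'; induction H; intros b' E;
    (* Arguments such as [⟨a, b⟩] are not constructor terms: they become a variable, and the
       equations left by [inversion] are split by injectivity of the pairing. *)
    match type of E with eval _ _ ?x _ => remember x as arg eqn:Earg end;
    inversion E; subst;
    repeat match goal with
    | H : Cantor.to_nat _ = Cantor.to_nat _ |- _ =>
        apply Cantor.to_nat_inj, pair_equal_spec in H; destruct H; subst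
    | H : S _ = S _ |- _ => apply Nat.succ_inj in H; subst
    end; try congruence; try discriminate.
  - now rewrite (IHeval1 b0), (IHeval2 c0).
  - assert (b = b0) by auto; subst; auto.
  - auto.
  - assert (b = b0) by auto; subst; auto.
  (* At the smaller of two distinct least zeros, [f] would have both the value 0 and a successor
     value. *)
  - destruct (Nat.lt_trichotomy n b') as [Hl|[Hl|Hl]]; [|exact Hl|].
    + match goal with Hv : forall m, m < b' -> eval _ _ _ _ |- _ =>
        specialize (IHeval _ (Hv n Hl)); discriminate end.
    + assert (X : S (v b') = 0) by (eapply H0; eauto).
      discriminate.
Qed.

Lemma eval_use (p : baire) (c : code) (a b : nat) :
  eval p c a b -> exists l, forall q, agree l p q -> eval q c a b.
Proof.
  intros H; induction H;
    repeat match goal with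
    | H : ex _ |- _ =>
        let l := fresh "l" in let Hl := fresh "Hl" in destruct H as [l Hl]
    end.
  1-4: exists 0; intros; constructor.
  - exists (S a); intros q Hq; rewrite (Hq a) by lia; constructor.
  - exists (max l l0); intros q Hq; constructor;
      [apply Hl0|apply Hl]; (eapply agree_le; [|exact Hq]; lia).
  - exists (max l l0); intros q Hq; econstructor;
      [apply Hl0|apply Hl]; (eapply agree_le; [|exact Hq]; lia).
  - exists l; intros q Hq; constructor; auto.
  - exists (max l l0); intros q Hq; econstructor;
      [apply Hl0|apply Hl]; (eapply agree_le; [|exact Hq]; lia).
  (* The finitely many computations below the least zero have a common use. *)
  - destruct (uniform_bound
      (fun m l => forall q, agree l p q -> eval q f ⟨a, m⟩ (S (v m))) n)
      as [l' Hl'].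
    + intros m x y Hxy Hx q Hq; apply Hx; eapply agree_le; eauto.
    + assumption.
    + exists (max l l'); intros q Hq; apply eval_mu with v.
      * intros m Hm; apply Hl'; [exact Hm|]; eapply agree_le; [|exact Hq]; lia.
      * apply Hl; eapply agree_le; [|exact Hq]; lia.
Qed.

Lemma interleave_agree (l : nat) (p p' r r' : baire) :
  agree l p p' -> agree l r r' -> agree l (interleave p r) (interleave p' r').
Proof.
  intros Hp Hr n Hn; unfold interleave.
  assert (Nat.div2 n <= n) by (apply Nat.div2_decr; lia).
  destruct (Nat.even n); [apply Hp|apply Hr]; lia.
Qed.

(** A name of a sequence all of whose entries have constant names: [g] turns the number [u i] into a
    name entry, so one format serves for natural numbers and for rationals. *)
Definition const_names (g : nat -> nat) (u : baire) : baire :=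
  fun n => g (u (fst (Cantor.of_nat n))).

Lemma const_names_eq (g : nat -> nat) (u : baire) (i j : nat) :
  const_names g u ⟨i, j⟩ = g (u i).
Proof. unfold const_names; now rewrite Cantor.cancel_of_to. Qed.

Lemma of_nat_fst_le (n : nat) : fst (Cantor.of_nat n) <= n.
Proof.
  rewrite <- (Cantor.cancel_to_of n) at 2.
  destruct (Cantor.of_nat n) as [x y].
  pose proof (Cantor.to_nat_non_decreasing x y); simpl fst; lia.
Qed.

Lemma const_names_agree (g : nat -> nat) (l : nat) (u u' : baire) :
  agree l u u' -> agree l (const_names g u) (const_names g u').
Proof.
  intros H n Hn; unfold const_names; rewrite H; [reflexivity|].
  pose proof (of_nat_fst_le n); lia.
Qed.

(** * Weihrauch reductions *)

(** Any name of any solution may be fed to the outer functional: change a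
    realizer at the single point [k]. *)
Lemma weihrauch_le_codes {X Y Z W : repspace} (f : mvfun X Y) (g : mvfun Z W) :
  f ≤W g -> exists cH cK : code, forall p x, delta p x -> dom f x ->
    exists k z, (forall n, eval p cK n (k n)) /\ delta k z /\ dom g z /\
      forall w r, g z w -> delta r w ->
      exists s v, (forall n, eval (interleave p r) cH n (s n)) /\
        delta s v /\ f x v.
Proof.
  intros (H & K & [cH HH] & [cK HK] & Hred).
  exists cH, cK; intros p x Hp Hx.
  pose (good := fun k q => exists z w, delta k z /\ g z w /\ delta q w).
  pose (sel := fun k => epsilon (inhabits k) (good k)).
  assert (Hsel : forall k, (exists q, good k q) -> good k (sel k))
    by (intros k Hk; apply epsilon_spec; exact Hk).
  assert (Hall : forall s : baire -> baire,
    (forall k, (exists q, good k q) -> good k (s k)) ->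
    exists k r y, K p k /\ good k (s k) /\ H (interleave p (s k)) r /\
      delta r y /\ f x y).
  { intros s Hs.
    assert (Hfun : forall k q q', q = s k /\ good k q -> q' = s k /\ good k q' ->
      q = q') by (intros; intuition congruence).
    pose (G := Pfun (fun k q => q = s k /\ good k q) Hfun).
    assert (HG : realizes G g).
    { intros k z Hk [w Hw]; destruct (delta_surj _ w) as [q0 Hq0].
      assert (Hg : good k (s k)) by (apply Hs; exists q0, z, w; auto).
      pose proof Hg as (z' & w' & Hz' & Hw' & Hd).
      rewrite (graph_fun _ _ _ _ _ _ Hz' Hk) in Hw'.
      exists (s k), w'; simpl; auto. }
    destruct (Hred G HG p x Hp Hx) as (r & y & (k & q & Hk & [-> Hq] & Hr) & Hy).
    exists k, r, y; tauto. }
  destruct (Hall sel Hsel) as (k & _ & _ & Hk & (z & w & Hz & Hw & _) & _).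
  exists k, z; split; [|split; [|split]].
  - now apply HK.
  - exact Hz.
  - now exists w.
  - intros w' r Hw' Hr.
    pose (s := fun k' => if excluded_middle_informative (k' = k)
                         then r else sel k').
    destruct (Hall s) as (k' & t & y & Hk' & _ & Ht & Hy).
    { intros k'; unfold s; destruct excluded_middle_informative as [->|_].
      - intros _; exists z, w'; auto.
      - apply Hsel. }
    (* [K] is single-valued and independent of the realizer, so [s] meets the same inner instance
       [k] as [sel]. *)
    rewrite (graph_fun _ _ _ _ _ _ Hk' Hk) in Ht; unfold s in Ht.
    destruct excluded_middle_informative as [_|Hn]; [|congruence].
    exists t, y; split; [now apply HH|exact Hy].
Qed.

(** * Cluster points *)

Lemma ValAdh_iff (x : nat -> R) (y : R) :
  ValAdh x y <->
  forall eps, (0 < eps)%R -> forall N, exists n, N <= n /\ (Rabs (x n - y) < eps)%R.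
Proof.
  split.
  - intros H eps He N.
    apply (H (disc y (mkposreal eps He)) N).
    exists (mkposreal eps He); intros z Hz; exact Hz.
  - intros H V N [[d Hd] HV].
    destruct (H d Hd N) as (n & Hn & Hx).
    exists n; split; [exact Hn|apply HV; exact Hx].
Qed.

Lemma bounded_cluster (x : nat -> R) : bounded_seq x -> exists y, ValAdh x y.
Proof.
  intros H; apply dom_BWT_R in H; destruct H as [y [_ Hy]]; now exists y.
Qed.

Lemma ValAdh_subseq (x : nat -> R) (i : nat -> nat) (y : R) :
  (forall n, n <= i n) -> ValAdh (fun n => x (i n)) y -> ValAdh x y.
Proof.
  intros Hi; rewrite !ValAdh_iff; intros H eps He N.
  destruct (H eps He N) as (n & Hn & Hx).
  exists (i n); split; [specialize (Hi n); lia|exact Hx].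
Qed.

Lemma inv_pow2_pos (m : nat) : (0 < / 2 ^ m)%R.
Proof. apply Rinv_0_lt_compat, pow_lt; lra. Qed.

Lemma inv_pow2_le (m k : nat) : m <= k -> (/ 2 ^ k <= / 2 ^ m)%R.
Proof.
  intros H; apply Rinv_le_contravar; [apply pow_lt; lra|apply Rle_pow; [lra|lia]].
Qed.

Lemma inv_pow2_small (eps : R) :
  (0 < eps)%R -> exists N, forall n, N <= n -> (/ 2 ^ n < eps)%R.
Proof.
  intros He; destruct (pow_lt_1_zero (/ 2)) with (y := eps) as [N HN];
    [rewrite Rabs_pos_eq; lra|exact He|].
  exists N; intros n Hn; specialize (HN n Hn).
  rewrite pow_inv, Rabs_pos_eq in HN by (pose proof (inv_pow2_pos n); lra).
  exact HN.
Qed.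

(** Distances tending to zero do not affect cluster points; this allows real entries to be replaced
    by rational approximations. *)
Lemma ValAdh_close (x z : nat -> R) (y : R) :
  (forall i, Rabs (x i - z i) <= / 2 ^ i)%R -> ValAdh x y -> ValAdh z y.
Proof.
  intros Hc; rewrite !ValAdh_iff; intros H eps He N.
  destruct (inv_pow2_small (eps / 2)) as [M HM]; [lra|].
  destruct (H (eps / 2)%R ltac:(lra) (max N M)) as (n & Hn & Hx).
  exists n; split; [lia|].
  specialize (HM n ltac:(lia)); specialize (Hc n).
  revert Hx Hc; unfold Rabs; repeat destruct Rcase_abs; lra.
Qed.

Lemma ValAdh_in_closed_interval (x : nat -> R) (a b y : R) (N : nat) :
  (forall n, N <= n -> (a <= x n <= b)%R) -> ValAdh x y -> (a <= y <= b)%R.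
Proof.
  intros Hx Hy; rewrite ValAdh_iff in Hy; split; apply Rnot_lt_le; intros Hl.
  - destruct (Hy (a - y)%R ltac:(lra) N) as (n & Hn & Hd).
    specialize (Hx n Hn); revert Hd; unfold Rabs; destruct Rcase_abs; lra.
  - destruct (Hy (y - b)%R ltac:(lra) N) as (n & Hn & Hd).
    specialize (Hx n Hn); revert Hd; unfold Rabs; destruct Rcase_abs; lra.
Qed.

(** * Names of reals and their prefixes *)

Lemma real_delta_error (r : baire) (y : R) (m : nat) :
  real_delta r y -> (Rabs (ratR (r m) - y) <= / 2 ^ m)%R.
Proof.
  intros [Hc Hl]; apply Rnot_lt_le; intros H.
  set (eps := (Rabs (ratR (r m) - y) - / 2 ^ m)%R) in *.
  destruct (Hl eps) as [N HN]; [unfold eps; lra|].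
  specialize (HN (S (max N m)) ltac:(lia)).
  specialize (Hc m (S (max N m)) ltac:(lia)).
  unfold Rdist in HN; unfold eps in *.
  pose proof (Rabs_triang (ratR (r m) - ratR (r (S (max N m))))
    (ratR (r (S (max N m))) - y)) as T.
  replace (ratR (r m) - ratR (r (S (max N m))) + (ratR (r (S (max N m))) - y))%R
    with (ratR (r m) - y)%R in T by ring.
  lra.
Qed.

(** The factor 1/2 leaves room for the triangle inequality: for [k > m] the two errors sum to at
    most 3/4 of [/ 2 ^ m]. *)
Lemma real_delta_of_error (r : baire) (y : R) :
  (forall m, Rabs (ratR (r m) - y) <= / 2 ^ m / 2)%R -> real_delta r y.
Proof.
  intros H; split.
  - intros m k Hmk.
    pose proof (H m) as H1; pose proof (H k) as H2.
    pose proof (inv_pow2_le (S m) k Hmk) as H3; pose proof (inv_pow2_pos m).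
    simpl in H3; rewrite Rinv_mult in H3.
    revert H1 H2; unfold Rabs; repeat destruct Rcase_abs; lra.
  - intros eps He; destruct (inv_pow2_small eps He) as [N HN].
    exists N; intros n Hn; specialize (HN n Hn); specialize (H n).
    pose proof (inv_pow2_pos n); unfold Rdist; lra.
Qed.

Lemma real_delta_const (i : nat) : real_delta (fun _ => i) (ratR i).
Proof.
  apply real_delta_of_error; intros m.
  rewrite Rminus_diag, Rabs_R0; pose proof (inv_pow2_pos m); lra.
Qed.

Lemma strict_name (y : R) :
  exists r : baire, forall m, (Rabs (ratR (r m) - y) < / 2 ^ m / 2)%R.
Proof.
  apply (ClassicalEpsilon.choice (fun m i => (Rabs (ratR i - y) < / 2 ^ m / 2)%R)).
  intros m; apply ratR_dense; pose proof (inv_pow2_pos m); lra.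
Qed.

(** Iterated pairing without a stored length; it codes words and also packs several parameters into
    the index of one requirement. *)
Fixpoint code_nth (c m : nat) : nat :=
  match m with
  | 0 => fst (Cantor.of_nat c)
  | S m' => code_nth (snd (Cantor.of_nat c)) m'
  end.

Lemma code_nth_surj (l : nat) (f : nat -> nat) :
  exists c, forall m, m < l -> code_nth c m = f m.
Proof.
  revert f; induction l as [|l IH]; intros f; [exists 0; lia|].
  destruct (IH (fun m => f (S m))) as [c Hc].
  exists ⟨f 0, c⟩; intros [|m] Hm; cbn -[Cantor.to_nat Cantor.of_nat];
    rewrite Cantor.cancel_of_to; simpl; [reflexivity|apply Hc; lia].
Qed.

(** The number [⟨l, d⟩] codes the word [code_nth d 0, ..., code_nth d (l - 1)]. *)
Definition starts_with (c : nat) (r : baire) : Prop :=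
  forall m, m < fst (Cantor.of_nat c) ->
    r m = code_nth (snd (Cantor.of_nat c)) m.

(** A closed set of reals having a name that starts with the word [c]. *)
Definition nbhd (c : nat) (y : R) : Prop :=
  forall m, m < fst (Cantor.of_nat c) ->
    (Rabs (ratR (code_nth (snd (Cantor.of_nat c)) m) - y) <= / 2 ^ m / 2)%R.

Lemma prefix_code (r : baire) (l : nat) :
  exists c, starts_with c r /\ forall r', starts_with c r' -> agree l r r'.
Proof.
  destruct (code_nth_surj l r) as [d Hd].
  exists ⟨l, d⟩; unfold starts_with; rewrite Cantor.cancel_of_to; simpl; split.
  - intros m Hm; symmetry; auto.
  - intros r' Hr m Hm; rewrite Hr, Hd; auto.
Qed.

Lemma nbhd_name (c : nat) (y : R) :
  nbhd c y -> exists r, real_delta r y /\ starts_with c r.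
Proof.
  intros H; destruct (strict_name y) as [r Hr].
  exists (fun m => if lt_dec m (fst (Cantor.of_nat c))
                   then code_nth (snd (Cantor.of_nat c)) m else r m); split.
  - apply real_delta_of_error; intros m; destruct lt_dec; auto.
    left; apply Hr.
  - intros m Hm; destruct lt_dec; [reflexivity|lia].
Qed.

Lemma uniform_radius (Q : nat -> R -> Prop) (n : nat) :
  (forall m e e', (e' <= e)%R -> Q m e -> Q m e') ->
  (forall m, m < n -> exists e, (0 < e)%R /\ Q m e) ->
  exists e, (0 < e)%R /\ forall m, m < n -> Q m e.
Proof.
  intros Hmon; induction n as [|n IH]; intros H.
  - exists 1%R; split; [lra|lia].
  - destruct IH as (e & He & HQ); [intros m Hm; apply H; lia|].
    destruct (H n) as (e' & He' & HQ'); [lia|].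
    exists (Rmin e e'); split; [now apply Rmin_pos|].
    intros m Hm; destruct (Nat.eq_dec m n) as [->|Hne].
    + apply Hmon with e'; [apply Rmin_r|exact HQ'].
    + apply Hmon with e; [apply Rmin_l|apply HQ; lia].
Qed.

(** A strict name meets the finitely many inequalities of its prefix with positive slack, which
    bounds the radius. *)
Lemma nbhd_interior (c : nat) (r : baire) (y : R) :
  (forall m, Rabs (ratR (r m) - y) < / 2 ^ m / 2)%R -> starts_with c r ->
  exists eps, (0 < eps)%R /\ forall z, (Rabs (z - y) < eps)%R -> nbhd c z.
Proof.
  intros Hr Hc.
  destruct (uniform_radius (fun m e => forall z, (Rabs (z - y) < e)%R ->
    (Rabs (ratR (code_nth (snd (Cantor.of_nat c)) m) - z) <= / 2 ^ m / 2)%R)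
    (fst (Cantor.of_nat c))) as (e & He & H).
  - intros m e e' Hle H z Hz; apply H; lra.
  - intros m Hm; rewrite <- (Hc m Hm).
    exists (/ 2 ^ m / 2 - Rabs (ratR (r m) - y))%R.
    specialize (Hr m); split; [lra|intros z Hz].
    revert Hr Hz; unfold Rabs; repeat destruct Rcase_abs; lra.
  - exists e; split; [exact He|intros z Hz m Hm; now apply H].
Qed.

Lemma nbhd_closed (c : nat) (y : R) :
  ~ nbhd c y ->
  exists eps, (0 < eps)%R /\ forall z, (Rabs (z - y) < eps)%R -> ~ nbhd c z.
Proof.
  intros H; apply not_all_ex_not in H; destruct H as [m H].
  apply imply_to_and in H; destruct H as [Hm H]; apply Rnot_le_lt in H.
  eexists; split; [apply Rlt_0_minus in H; exact H|].
  intros z Hz Hn; specialize (Hn m Hm).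
  revert H Hz Hn; unfold Rabs; repeat destruct Rcase_abs; lra.
Qed.

(** A finite union of closed sets is closed. *)
Lemma ValAdh_nbhd (x : nat -> R) (y : R) (w : nat -> nat) (n N : nat) :
  (forall i, N <= i -> exists j, j < n /\ nbhd (w j) (x i)) -> ValAdh x y ->
  exists j, j < n /\ nbhd (w j) y.
Proof.
  intros Hx Hy; apply NNPP; intros Hn.
  destruct (uniform_radius (fun j e => forall z, (Rabs (z - y) < e)%R ->
    ~ nbhd (w j) z) n) as (e & He & H).
  - intros m e e' Hle H z Hz; apply H; lra.
  - intros m Hm; apply nbhd_closed; intros H; apply Hn; exists m; auto.
  - rewrite ValAdh_iff in Hy; destruct (Hy e He N) as (i & Hi & Hd).
    destruct (Hx i Hi) as (j & Hj & Hw); exact (H j Hj _ Hd Hw).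
Qed.

(** Compactness of the set of cluster points of a bounded sequence. *)
Lemma cluster_cover (x : nat -> R) (good : nat -> Prop) :
  bounded_seq x ->
  (forall y, ValAdh x y -> exists c eps, good c /\ (0 < eps)%R /\
     forall z, (Rabs (z - y) < eps)%R -> nbhd c z) ->
  exists (w : nat -> nat) (n N : nat), (forall j, j < n -> good (w j)) /\
    forall i, N <= i -> exists j, j < n /\ nbhd (w j) (x i).
Proof.
  intros [M HM] Hg.
  destruct (bounded_cluster x (ex_intro _ M HM)) as [y0 Hy0].
  destruct (Hg y0 Hy0) as (c0 & _ & Hc0 & _).
  (* [w] enumerates the good words, with [c0] as the default at the other numbers. *)
  pose (w := fun j => if excluded_middle_informative (good j) then j else c0).
  assert (Hw : forall j, good (w j))
    by (intros j; unfold w; destruct excluded_middle_informative; auto).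
  apply NNPP; intros Hn.
  (* If no finite part of the enumeration covers a tail, some entries escape longer and longer
     parts; their cluster point lies inside a good [nbhd c], which they avoid from [S c] on. *)
  assert (Hi : forall n, exists i, n <= i /\
    forall j, j < n -> ~ nbhd (w j) (x i)).
  { intros n; apply NNPP; intros H; apply Hn; exists w, n, n; split; [auto|].
    intros i Hi; apply NNPP; intros Hj; apply H; exists i; split; [exact Hi|].
    intros j Hlt Hb; apply Hj; now exists j. }
  apply ClassicalEpsilon.choice in Hi; destruct Hi as [i Hi].
  destruct (bounded_cluster (fun n => x (i n))) as [y Hy]; [now exists M|].
  destruct (Hg y) as (c & e & Hc & He & Hb).
  { apply ValAdh_subseq with i; [apply Hi|exact Hy]. }
  rewrite ValAdh_iff in Hy; destruct (Hy e He (S c)) as (n & Hlt & Hd).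
  apply (proj2 (Hi n) c ltac:(lia)).
  unfold w; destruct excluded_middle_informative; [auto|contradiction].
Qed.

(** * Fusion *)

(** A condition allows the sequences that agree with [point] below [len] and
    take values in [allowed] from there on. *)
Record cond : Type := Cond {
  point : baire;
  len : nat;
  allowed : nat -> Prop
}.

Definition extends (u : baire) (c : cond) : Prop :=
  agree (len c) (point c) u /\ forall s, len c <= s -> allowed c (u s).

Definition stronger (c' c : cond) : Prop :=
  len c <= len c' /\ extends (point c') c /\
  forall i, allowed c' i -> allowed c i.

Definition valid (c : cond) : Prop := extends (point c) c.

Lemma stronger_extends (c' c : cond) (u : baire) :
  stronger c' c -> extends u c' -> extends u c.
Proof.
  intros (Hl & [Ha Hs] & Hi) [Ha' Hs']; split.
  - intros m Hm; rewrite Ha, Ha'; auto; lia.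
  - intros s Hs0; destruct (le_lt_dec (len c') s) as [H|H]; auto.
    rewrite <- Ha' by exact H; auto.
Qed.

Lemma stronger_refl (c : cond) : valid c -> stronger c c.
Proof. intros H; split; [lia|split; auto]. Qed.

Lemma stronger_trans (c1 c2 c3 : cond) :
  stronger c1 c2 -> stronger c2 c3 -> stronger c1 c3.
Proof.
  intros H1 H2; split; [|split].
  - destruct H1, H2; lia.
  - apply (stronger_extends _ _ _ H2), H1.
  - destruct H1 as (_ & _ & H1), H2 as (_ & _ & H2); auto.
Qed.

(** With [l] the use of a computation along [u], the lengthened condition forces its outcome. *)
Lemma refine_at (c : cond) (u : baire) (l : nat) :
  extends u c -> let c' := Cond u (max (len c) l) (allowed c) in
  valid c' /\ stronger c' c /\ forall u', extends u' c' -> agree l u u'.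
Proof.
  intros H c'; repeat split; simpl; auto; try (intros; lia).
  - intros s Hs; apply H; lia.
  - apply H.
  - apply H.
  - intros u' [Hu _]; eapply agree_le; [|exact Hu]; simpl; lia.
Qed.

Definition splice (l : nat) (u : baire) (x : nat) : baire :=
  fun s => if lt_dec s l then u s else x.

Lemma splice_agree (l : nat) (u : baire) (x : nat) : agree l u (splice l u x).
Proof. intros m Hm; unfold splice; destruct lt_dec; [reflexivity|lia]. Qed.

Lemma splice_ge (l : nat) (u : baire) (x s : nat) : l <= s -> splice l u x s = x.
Proof. intros Hs; unfold splice; destruct lt_dec; [lia|reflexivity]. Qed.

Lemma splice_extends (c : cond) (u : baire) (l x : nat) :
  extends u c -> len c <= l -> allowed c x -> extends (splice l u x) c.
Proof.
  intros [Ha Hs] Hl Hx; split.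
  - intros m Hm; rewrite (Ha m Hm); apply splice_agree; lia.
  - intros s Hs'; unfold splice; destruct lt_dec; auto.
Qed.

Lemma narrow (c : cond) (S : nat -> Prop) (x : nat) :
  valid c -> (forall i, S i -> allowed c i) -> S x ->
  exists c', allowed c' = S /\ valid c' /\ stronger c' c.
Proof.
  intros Hc HS Hx; exists (Cond (splice (len c) (point c) x) (len c) S).
  repeat split; simpl; auto.
  - intros s Hs; now rewrite splice_ge.
  - apply splice_extends; auto.
  - apply splice_extends; auto.
Qed.

(** The requirements [Q n] are met one after another along a descending chain of conditions, whose
    points converge to a member of all of them. [J] is the shape of allowed set preserved along the
    chain. *)
Lemma fusion (J : (nat -> Prop) -> Prop) (Q : nat -> cond -> Prop) (c0 : cond) :
  (forall n c, valid c -> J (allowed c) -> stronger c c0 ->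
     exists c', valid c' /\ J (allowed c') /\ stronger c' c /\ Q n c') ->
  valid c0 -> J (allowed c0) ->
  exists u, extends u c0 /\
    forall n, exists c', valid c' /\ J (allowed c') /\ extends u c' /\ Q n c'.
Proof.
  intros HQ Hv0 HJ0.
  pose (P := fun n c c' => valid c' /\ J (allowed c') /\ stronger c' c /\
    n <= len c' /\ Q n c').
  pose (next := fun n c => epsilon (inhabits c0) (P n c)).
  pose (ch := nat_rect (fun _ => cond) c0 next).
  assert (Hnext : forall n c, valid c -> J (allowed c) -> stronger c c0 ->
    P n c (next n c)).
  { intros n c Hv HJ H0; apply epsilon_spec.
    (* Lengthening before each requirement makes the lengths unbounded. *)
    destruct (refine_at c (point c) n Hv) as (Hv1 & Hs1 & _).
    destruct (HQ n _ Hv1 HJ (stronger_trans _ _ _ Hs1 H0))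
      as (c' & Hv' & HJ' & Hs' & Hq').
    exists c'; split; [exact Hv'|split; [exact HJ'|split; [|split]]].
    - exact (stronger_trans _ _ _ Hs' Hs1).
    - destruct Hs' as [Hl _]; simpl in Hl; lia.
    - exact Hq'. }
  assert (Hch : forall n, valid (ch n) /\ J (allowed (ch n)) /\ stronger (ch n) c0).
  { induction n as [|n (IH1 & IH2 & IH3)]; [now auto using stronger_refl|].
    destruct (Hnext n _ IH1 IH2 IH3) as (H1 & H2 & H3 & _).
    split; [exact H1|split; [exact H2|exact (stronger_trans _ _ _ H3 IH3)]]. }
  assert (Hstep : forall n, P n (ch n) (ch (S n)))
    by (intros n; apply Hnext; apply Hch).
  assert (Hmono : forall n m, n <= m -> stronger (ch m) (ch n)).
  { intros n m H; induction H as [|m H IH]; [apply stronger_refl, Hch|].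
    apply stronger_trans with (ch m); [apply Hstep|exact IH]. }
  assert (Hlen : forall n, n <= len (ch (S n))) by (intros n; apply Hstep).
  (* The length of [ch (S (S s))] is at least [S s], so its point is settled at [s]. *)
  pose (u := fun s => point (ch (S (S s))) s).
  assert (Hu : forall n s, s < len (ch n) -> u s = point (ch n) s).
  { intros n s Hs; unfold u.
    destruct (Hmono n (max n (S (S s))) ltac:(lia)) as (_ & [H1 _] & _).
    destruct (Hmono (S (S s)) (max n (S (S s))) ltac:(lia)) as (_ & [H2 _] & _).
    rewrite H1, H2; auto; specialize (Hlen (S s)); lia. }
  assert (Hext : forall n, extends u (ch n)).
  { intros n; split.
    - intros m Hm; symmetry; auto.
    - intros s Hs; destruct (Hmono n (max n (S (S s))) ltac:(lia)) as (_ & [_ H] & _).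
      rewrite (Hu (max n (S (S s)))); auto.
      destruct (Hmono (S (S s)) (max n (S (S s))) ltac:(lia)) as (H' & _).
      specialize (Hlen (S s)); lia. }
  exists u; split; [apply (Hext 0)|].
  intros n; exists (ch (S n)); repeat split; try apply Hch; try apply Hext.
  apply Hstep.
Qed.

(** * Cluster points of bounded sequences do not find recurrent values *)

Definition only_recurrent (u : baire) (c : nat) : Prop :=
  (forall N, exists s, N <= s /\ u s = c) /\
  forall d, d <> c -> exists N, forall s, N <= s -> u s <> d.

(** The graph of a continuous partial map on Baire space: [A u i b] reads as entry [i] of the image
    of [u] being [b]. *)
Definition locally_determined (A : baire -> nat -> nat -> Prop) : Prop :=
  (forall u i b b', A u i b -> A u i b' -> b = b') /\
  forall u i b, A u i b -> exists l, forall u', agree l u u' -> A u' i b.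

Definition locally_determined2 (B : baire -> baire -> nat -> nat -> Prop) : Prop :=
  (forall u r j b b', B u r j b -> B u r j b' -> b = b') /\
  forall u r j b, B u r j b ->
    exists l, forall u' r', agree l u u' -> agree l r r' -> B u' r' j b.

Definition covered (d n : nat) (y : R) : Prop :=
  exists j, j < n /\ nbhd (code_nth d j) y.

(** Along a generic [u] the outer computation [B] answers [0] on a finite union
    of neighbourhoods that the inner output cannot leave any more; switching to
    a fresh constant value afterwards makes this answer wrong. *)
Lemma recurrent_value_not_from_cluster
    (A : baire -> nat -> nat -> Prop) (B : baire -> baire -> nat -> nat -> Prop)
    (P : nat -> nat -> Prop) (j0 : nat) :
  locally_determined A -> locally_determined2 B ->
  (forall c c' b, P c b -> P c' b -> c = c') ->
  ~ (forall u c, only_recurrent u c -> exists k : baire,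
       (forall i, A u i (k i)) /\ bounded_seq (fun i => ratR (k i)) /\
       forall y r, ValAdh (fun i => ratR (k i)) y -> real_delta r y ->
       exists b, B u r j0 b /\ P c b).
Proof.
  intros [Adet Aloc] [Bdet Bloc] Pinj Hred.
  (* The value 0 and all fresh values above [t] stay available. *)
  pose (J := fun S : nat -> Prop => exists t, forall i, S i <-> i = 0 \/ t < i).
  (* The index [e] packs a cover and a bound [m]. The condition either forces an inner entry past
     [m] outside the cover or confines all of them to it; it also adds a late 0 and forbids nonzero
     values up to [e]. *)
  pose (Q := fun e c =>
    (let d := code_nth e 0 in let n := code_nth e 1 in let m := code_nth e 2 in
     (exists i b, m <= i /\ ~ covered d n (ratR b) /\
        forall u, extends u c -> A u i b) \/
     (forall u i b, extends u c -> m <= i -> A u i b -> covered d n (ratR b))) /\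
    (exists s, e <= s /\ forall u, extends u c -> u s = 0) /\
    (forall i, allowed c i -> i = 0 \/ e < i)).
  destruct (fusion J Q) with (c0 := Cond (fun _ => 0) 0 (fun i => i = 0 \/ 0 < i))
    as (u & _ & Hu).
  { intros e c Hv [t Ht] _.
    set (d := code_nth e 0); set (n := code_nth e 1); set (m := code_nth e 2).
    assert (H1 : exists c1, valid c1 /\ stronger c1 c /\ allowed c1 = allowed c /\
      ((exists i b, m <= i /\ ~ covered d n (ratR b) /\
        forall u, extends u c1 -> A u i b) \/
       (forall u i b, extends u c1 -> m <= i -> A u i b -> covered d n (ratR b)))).
    { destruct (classic (exists u i b, extends u c /\ m <= i /\ A u i b /\
        ~ covered d n (ratR b))) as [(u & i & b & Hu & Hi & Hb & Hn)|Hno].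
      - destruct (Aloc _ _ _ Hb) as [l Hl].
        destruct (refine_at c u l Hu) as (Hv1 & Hs1 & Ha1).
        eexists; split; [exact Hv1|split; [exact Hs1|split; [reflexivity|left]]].
        exists i, b; auto.
      - exists c; split; [exact Hv|split; [now apply stronger_refl|]].
        split; [reflexivity|right]; intros u i b Hu Hi Hb.
        apply NNPP; intros Hn; apply Hno; exists u, i, b; auto. }
    destruct H1 as (c1 & Hv1 & Hs1 & Ha1 & Hq1).
    set (s := max (len c1) e).
    assert (Hsp : extends (splice s (point c1) 0) c1).
    { apply splice_extends; [exact Hv1|unfold s; lia|].
      rewrite Ha1; apply Ht; auto. }
    destruct (refine_at c1 _ (S s) Hsp) as (Hv2 & Hs2 & Hag2).
    set (c2 := Cond _ _ _) in *.
    destruct (narrow c2 (fun i => i = 0 \/ max t e < i) 0) as (c3 & Ha3 & Hv3 & Hs3).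
    - exact Hv2.
    - intros i Hi; simpl; rewrite Ha1; apply Ht; destruct Hi; [auto|right; lia].
    - auto.
    - assert (H32 : forall u, extends u c3 -> extends u c2)
        by (intros u; apply stronger_extends, Hs3).
      assert (H31 : forall u, extends u c3 -> extends u c1)
        by (intros u Hu; apply (stronger_extends _ _ _ Hs2); auto).
      exists c3; split; [exact Hv3|split; [|split; [|split; [|split]]]].
      + exists (max t e); intros i; rewrite Ha3; reflexivity.
      + eapply stronger_trans; [exact Hs3|].
        eapply stronger_trans; [exact Hs2|exact Hs1].
      + fold d n m; destruct Hq1 as [(i & b & Hi & Hn & Hb)|Hno].
        * left; exists i, b; auto.
        * right; intros u i b Hu; apply Hno; auto.
      + exists s; split; [unfold s; lia|]; intros u Hu.
        rewrite <- (Hag2 u (H32 u Hu) s) by lia; now apply splice_ge.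
      + intros i; rewrite Ha3; intros [->|Hi]; [auto|right; lia]. }
  { split; simpl; [intros m Hm; lia|auto]. }
  { exists 0; simpl; tauto. }
  assert (Hrec : only_recurrent u 0).
  { split.
    - intros N; destruct (Hu N) as (c & _ & _ & He & _ & (s & Hs & Hz) & _).
      exists s; auto.
    - intros d Hd; destruct (Hu d) as (c & _ & _ & [_ He] & _ & _ & Ha).
      exists (len c); intros s Hs Heq; destruct (Ha _ (He s Hs)); lia. }
  destruct (Hred u 0 Hrec) as (k & Hk & Hbd & Hout).
  (* The word [c] and a finite part of [u] already determine an answer accepted for 0. *)
  pose (good := fun c => exists l b, P 0 b /\ forall u' r', agree l u u' ->
    starts_with c r' -> B u' r' j0 b).
  destruct (cluster_cover (fun i => ratR (k i)) good Hbd) as (w & n & m & Hw & Hc).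
  { intros y Hy; destruct (strict_name y) as [r Hr].
    destruct (Hout y r Hy) as (b & Hb & Hp).
    { apply real_delta_of_error; intros i; left; apply Hr. }
    destruct (Bloc _ _ _ _ Hb) as [l Hl].
    destruct (prefix_code r l) as (c & Hc & Hc').
    destruct (nbhd_interior c r y Hr Hc) as (e & He & Hball).
    exists c, e; split; [|auto].
    exists l, b; split; auto. }
  destruct (code_nth_surj n w) as [d Hd].
  destruct (code_nth_surj 3 (fun x => match x with 0 => d | 1 => n | _ => m end))
    as [e He].
  destruct (Hu e) as (c & Hv & [t Ht] & Hext & Hq & _).
  rewrite (He 0), (He 1), (He 2) in Hq by lia; cbv beta iota zeta in Hq.
  (* The entries of [k] past [m] stay in the cover, which refutes the first alternative of [Q]. *)
  assert (Hcov : forall u i b, extends u c -> m <= i -> A u i b ->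
    covered d n (ratR b)).
  { destruct Hq as [(i & b & Hi & Hn & Hb)|Hq]; [|exact Hq].
    exfalso; apply Hn; rewrite (Adet u i b (k i)); auto.
    destruct (Hc i Hi) as (j & Hj & Hnb); exists j; now rewrite Hd. }
  destruct (uniform_bound (fun j l => exists b, P 0 b /\ forall u' r',
    agree l u u' -> starts_with (w j) r' -> B u' r' j0 b) n) as [l Hl].
  { intros j l l' Hll (b & Hp & Hb); exists b; split; [exact Hp|].
    intros u' r' Hu'; apply Hb; eapply agree_le; eauto. }
  { exact Hw. }
  set (L := max (len c) l).
  (* The constant [S t] is allowed by [c], and [q] agrees with [u] on the common use [l], yet 0 is
     no longer recurrent. *)
  set (q := splice L u (S t)).
  assert (Hqc : extends q c).
  { apply splice_extends; [exact Hext|unfold L; lia|apply Ht; right; lia]. }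
  destruct (Hred q (S t)) as (k' & Hk' & Hbd' & Hout').
  { split.
    - intros N; exists (max N L); split; [lia|apply splice_ge; lia].
    - intros x Hx; exists L; intros s Hs; unfold q; rewrite splice_ge; auto. }
  destruct (bounded_cluster _ Hbd') as [y Hy].
  destruct (ValAdh_nbhd _ y (code_nth d) n m (fun i Hi => Hcov q i _ Hqc Hi (Hk' i)) Hy)
    as (j & Hj & Hnb).
  rewrite Hd in Hnb by exact Hj.
  destruct (nbhd_name _ _ Hnb) as (r & Hr & Hst).
  destruct (Hout' y r Hy Hr) as (b & Hb & Hp).
  destruct (Hl j Hj) as (b0 & Hp0 & Hb0).
  assert (Hbb : B q r j0 b0).
  { apply Hb0; [|exact Hst].
    eapply agree_le; [|apply splice_agree]; unfold L; lia. }
  rewrite (Bdet _ _ _ _ _ Hb Hbb) in Hp.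
  discriminate (Pinj _ _ _ Hp Hp0).
Qed.

(** * Rational sequences confined to intervals *)

Definition in_range (a b : R) (i : nat) : Prop := (a <= ratR i <= b)%R.

Definition is_interval (S : nat -> Prop) : Prop :=
  exists a b, (a < b)%R /\ S = in_range a b.

Lemma in_range_inhabited (a b : R) : (a < b)%R -> exists i, in_range a b i.
Proof.
  intros H; destruct (ratR_dense ((a + b) / 2) ((b - a) / 2)) as [i Hi]; [lra|].
  exists i; unfold in_range; revert Hi; unfold Rabs; destruct Rcase_abs; lra.
Qed.

Lemma narrow_in_range (c : cond) (a b a' b' : R) :
  valid c -> allowed c = in_range a b -> (a <= a' < b')%R -> (b' <= b)%R ->
  exists c', allowed c' = in_range a' b' /\ valid c' /\ stronger c' c.
Proof.
  intros Hv Ha Hab Hb; destruct (in_range_inhabited a' b') as [x Hx]; [lra|].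
  apply narrow with x; auto.
  intros i; rewrite Ha; unfold in_range; lra.
Qed.

Lemma cluster_in_range (c : cond) (u : baire) (a b v : R) :
  allowed c = in_range a b -> extends u c -> ValAdh (fun s => ratR (u s)) v ->
  (a <= v <= b)%R.
Proof.
  intros Ha [_ Hs]; apply ValAdh_in_closed_interval with (len c).
  intros n Hn; specialize (Hs n Hn); now rewrite Ha in Hs.
Qed.

Lemma extends_bounded (c : cond) (u : baire) :
  is_interval (allowed c) -> extends u c -> bounded_seq (fun s => ratR (u s)).
Proof.
  intros (a & b & _ & Ha) [_ Hs].
  assert (H : forall n, exists M, forall s, s < n -> (Rabs (ratR (u s)) <= M)%R).
  { induction n as [|n [M HM]]; [exists 0%R; lia|].
    exists (Rmax M (Rabs (ratR (u n)))); intros s Hsn.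
    destruct (Nat.eq_dec s n) as [->|Hne]; [apply Rmax_r|].
    eapply Rle_trans; [apply HM; lia|apply Rmax_l]. }
  destruct (H (len c)) as [M HM].
  exists (Rmax M (Rabs a + Rabs b)); intros s.
  destruct (le_lt_dec (len c) s) as [Hl|Hl].
  - eapply Rle_trans; [|apply Rmax_r].
    specialize (Hs s Hl); rewrite Ha in Hs; destruct Hs as [H1 H2].
    revert H1 H2; unfold Rabs; repeat destruct Rcase_abs; lra.
  - eapply Rle_trans; [apply HM, Hl|apply Rmax_l].
Qed.

Lemma interval_cond : exists c, valid c /\ is_interval (allowed c).
Proof.
  destruct (in_range_inhabited 0 1) as [x Hx]; [lra|].
  exists (Cond (fun _ => x) 0 (in_range 0 1)); split.
  - split; simpl; [intros m Hm; lia|auto].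
  - exists 0%R, 1%R; split; [lra|reflexivity].
Qed.

(** Countably many candidates are defeated one after the other, each by moving
    to a subinterval away from the value that it promises. *)
Lemma cluster_not_countably_determined (B : nat -> baire -> nat -> nat -> Prop) :
  (forall n, locally_determined (B n)) ->
  ~ (forall u, bounded_seq (fun i => ratR (u i)) ->
     exists n s v, (forall j, B n u j (s j)) /\
       real_delta s v /\ ValAdh (fun i => ratR (u i)) v).
Proof.
  intros HB Hred.
  pose (Q := fun n c => forall u s v, extends u c -> (forall j, B n u j (s j)) ->
    real_delta s v -> ~ ValAdh (fun i => ratR (u i)) v).
  destruct interval_cond as (c0 & Hv0 & HJ0).
  destruct (fusion is_interval Q c0) as (u & Hext & Hu); [|exact Hv0|exact HJ0|].
  { intros n c Hv (a & b & Hab & Hc) _.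
    destruct (HB n) as [Bdet Bloc].
    (* With error below a quarter of the length, an approximation on one side of the midpoint keeps
       the value out of the outer quarter on the other side. *)
    destruct (inv_pow2_small ((b - a) / 4)) as [m Hm]; [lra|].
    specialize (Hm m (le_n m)).
    destruct (classic (exists u i, extends u c /\ B n u m i /\
      (ratR i < (a + b) / 2)%R)) as [(u & i & Hu & Hi & Hlt)|Hno].
    - destruct (Bloc _ _ _ Hi) as [l Hl].
      destruct (refine_at c u l Hu) as (Hv1 & Hs1 & Ha1).
      set (c1 := Cond _ _ _) in *.
      destruct (narrow_in_range c1 a b ((a + 3 * b) / 4) b)
        as (c2 & Ha2 & Hv2 & Hs2); [exact Hv1|exact Hc|lra|lra|].
      exists c2; split; [exact Hv2|split; [|split]].
      + rewrite Ha2; exists ((a + 3 * b) / 4)%R, b; split; [lra|reflexivity].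
      + eapply stronger_trans; [exact Hs2|exact Hs1].
      + intros u' s v Hu' Hs Hd Hadh.
        pose proof (cluster_in_range _ _ _ _ _ Ha2 Hu' Hadh) as Hr.
        pose proof (real_delta_error s v m Hd) as Her.
        rewrite (Bdet u' m (s m) i) in Her; auto.
        2: apply Hl, Ha1, (stronger_extends _ _ _ Hs2 Hu').
        revert Her; unfold Rabs; destruct Rcase_abs; lra.
    (* Every approximation available below [c] is at least the midpoint, so the first quarter is
       safe. *)
    - destruct (narrow_in_range c a b a ((3 * a + b) / 4))
        as (c2 & Ha2 & Hv2 & Hs2); [exact Hv|exact Hc|lra|lra|].
      exists c2; split; [exact Hv2|split; [|split]].
      + rewrite Ha2; exists a, ((3 * a + b) / 4)%R; split; [lra|reflexivity].
      + exact Hs2.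
      + intros u' s v Hu' Hs Hd Hadh.
        pose proof (cluster_in_range _ _ _ _ _ Ha2 Hu' Hadh) as Hr.
        pose proof (real_delta_error s v m Hd) as Her.
        assert (Hge : ~ (ratR (s m) < (a + b) / 2)%R).
        { intros Hlt; apply Hno; exists u', (s m).
          split; [exact (stronger_extends _ _ _ Hs2 Hu')|auto]. }
        revert Her; unfold Rabs; destruct Rcase_abs; lra. }
  destruct (Hred u (extends_bounded _ _ HJ0 Hext)) as (n & s & v & Hs & Hd & Hadh).
  destruct (Hu n) as (c & _ & _ & Hc & Hq).
  exact (Hq u s v Hc Hs Hd Hadh).
Qed.

(** * Cluster points against unique cluster points *)

Definition visits (A : baire -> nat -> nat -> Prop) (V : R -> Prop) (m : nat)
    (u : baire) : Prop :=
  exists i b, m <= i /\ A u i b /\ V (ratR b).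

Lemma visits_forced (A : baire -> nat -> nat -> Prop) (V : R -> Prop) (m : nat)
    (u : baire) (c : cond) :
  locally_determined A -> visits A V m u -> extends u c ->
  exists c', valid c' /\ allowed c' = allowed c /\ stronger c' c /\
    forall u', extends u' c' -> visits A V m u'.
Proof.
  intros [_ Aloc] (i & b & Hi & Hb & HV) Hu.
  destruct (Aloc _ _ _ Hb) as [l Hl].
  destruct (refine_at c u l Hu) as (Hv1 & Hs1 & Ha1).
  eexists; split; [exact Hv1|split; [reflexivity|split; [exact Hs1|]]].
  intros u' Hu'; exists i, b; auto.
Qed.

Definition ball0 (N : nat) (z : R) : Prop := (Rabs z <= INR N)%R.

(** Bolzano-Weierstrass, applied to inner entries in [[-N, N]] with unbounded indices. *)
Lemma infinitely_many_visits (A : baire -> nat -> nat -> Prop) (V : R -> Prop)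
    (N : nat) (u k : baire) :
  locally_determined A -> (forall i, A u i (k i)) ->
  (forall z, V z -> ball0 N z) -> (forall m, visits A V m u) ->
  exists i : nat -> nat, (forall m, m <= i m) /\
    (forall m, V (ratR (k (i m)))) /\
    exists y, ValAdh (fun m => ratR (k (i m))) y.
Proof.
  intros [Adet _] Hk HV Hvis.
  assert (H : forall m, exists i, m <= i /\ V (ratR (k i))).
  { intros m; destruct (Hvis m) as (i & b & Hi & Hb & HVb).
    exists i; split; [exact Hi|]; now rewrite (Adet u i (k i) b). }
  apply ClassicalEpsilon.choice in H; destruct H as [i Hi].
  exists i; split; [apply Hi|split; [apply Hi|]].
  apply bounded_cluster; exists (INR N); intros m; apply HV, Hi.
Qed.

(** The margin [/ 2 ^ j] is the error of the [j]-th approximation in a name, so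
    the real number announced by [B] lies outside [[lo, hi]]. *)
Definition excludes (B : baire -> baire -> nat -> nat -> Prop) (w : nat)
    (lo hi : R) (u : baire) : Prop :=
  exists l j b, (forall u' r, agree l u u' -> starts_with w r -> B u' r j b) /\
    (ratR b + / 2 ^ j < lo \/ hi < ratR b - / 2 ^ j)%R.

Definition solved_by_unique_cluster (A : baire -> nat -> nat -> Prop)
    (B : baire -> baire -> nat -> nat -> Prop) (u : baire) : Prop :=
  exists (k : baire) y, (forall i, A u i (k i)) /\
    ValAdh (fun i => ratR (k i)) y /\
    (forall z, ValAdh (fun i => ratR (k i)) z -> z = y) /\
    forall r, real_delta r y -> exists s v, (forall j, B u r j (s j)) /\
      real_delta s v /\ ValAdh (fun i => ratR (u i)) v.

Definition reduces_to_unique_cluster (A : baire -> nat -> nat -> Prop)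
    (B : baire -> baire -> nat -> nat -> Prop) : Prop :=
  locally_determined A /\ locally_determined2 B /\
  forall u, bounded_seq (fun i => ratR (u i)) -> solved_by_unique_cluster A B u.

(** The returns to [[-N, N]] eventually lie in [nbhd w], hence so does the unique cluster point. Fed
    a name of it starting with [w], the outer computation announces a value outside [[lo, hi]],
    where all cluster points of [u] lie. *)
Lemma excludes_contradiction (A : baire -> nat -> nat -> Prop)
    (B : baire -> baire -> nat -> nat -> Prop)
    (N w m : nat) (lo hi : R) (c : cond) (u : baire) :
  reduces_to_unique_cluster A B -> (lo < hi)%R ->
  allowed c = in_range lo hi -> extends u c ->
  (forall n, visits A (ball0 N) n u) ->
  ~ visits A (fun z => ball0 N z /\ ~ nbhd w z) m u ->
  ~ excludes B w lo hi u.
Proof.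
  intros (HA & HB & Hred) Hlt Ha Hu Hvis Hno (l & j & b & HBu & Hout).
  assert (Hi : is_interval (allowed c)) by (rewrite Ha; now exists lo, hi).
  destruct (Hred u (extends_bounded _ _ Hi Hu)) as (k & y & Hk & _ & Huniq & Hsol).
  destruct (infinitely_many_visits A (ball0 N) N u k HA Hk (fun z H => H) Hvis)
    as (i & Hge & Hball & y' & Hy').
  rewrite (Huniq y') in Hy' by (apply ValAdh_subseq with i; auto).
  destruct (ValAdh_nbhd (fun n => ratR (k (i n))) y (fun _ => w) 1 m)
    as (_ & _ & Hw); [|exact Hy'|].
  { intros n Hn; exists 0; split; [lia|]; apply NNPP; intros Hnb; apply Hno.
    exists (i n), (k (i n)); specialize (Hge n); split; [lia|auto]. }
  destruct (nbhd_name _ _ Hw) as (r & Hr & Hst).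
  destruct (Hsol r Hr) as (s & v & Hs & Hd & Hadh).
  pose proof (cluster_in_range _ _ _ _ _ Ha Hu Hadh) as Hv.
  pose proof (real_delta_error s v j Hd) as Her.
  rewrite (proj1 HB u r j (s j) b) in Her; auto.
  2: { apply HBu; [intros x Hx; reflexivity|exact Hst]. }
  revert Her; unfold Rabs; destruct Rcase_abs; lra.
Qed.

Lemma solution_excludes (B : baire -> baire -> nat -> nat -> Prop)
    (a h : R) (u r : baire) :
  locally_determined2 B -> (0 < h)%R ->
  (exists s v, (forall j, B u r j (s j)) /\ real_delta s v) ->
  exists w, starts_with w r /\
    (excludes B w a (a + h) u \/ excludes B w (a + 2 * h) (a + 3 * h) u).
Proof.
  intros HB Hh (s & v & Hs & Hd).
  (* The midpoint of [[a, a + 3 * h]] is [h / 2] away from both outer thirds, and the error counts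
     twice: for the approximation and for the margin in [excludes]. *)
  destruct (inv_pow2_small (h / 4)) as [j Hj]; [lra|].
  specialize (Hj j (le_n j)).
  destruct (proj2 HB _ _ _ _ (Hs j)) as [l Hl].
  destruct (prefix_code r l) as (w & Hw & Hw').
  exists w; split; [exact Hw|].
  pose proof (real_delta_error s v j Hd) as Her.
  destruct (Rle_lt_dec (a + 3 / 2 * h) v) as [Hv|Hv]; [left|right];
    exists l, j, (s j); (split; [auto|]); [right|left];
    revert Her; unfold Rabs; destruct Rcase_abs; lra.
Qed.

Lemma avoid_ball (A : baire -> nat -> nat -> Prop)
    (B : baire -> baire -> nat -> nat -> Prop)
    (N : nat) (c : cond) :
  reduces_to_unique_cluster A B -> valid c -> is_interval (allowed c) ->
  exists c' m, valid c' /\ is_interval (allowed c') /\ stronger c' c /\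
    forall u, extends u c' -> ~ visits A (ball0 N) m u.
Proof.
  intros HR Hv HJ; pose proof HR as (HA & HB & Hred); apply NNPP; intros Hno.
  assert (Hvis : forall c' m, valid c' -> is_interval (allowed c') ->
    stronger c' c -> exists u, extends u c' /\ visits A (ball0 N) m u).
  { intros c' m Hv' HJ' Hs'; apply NNPP; intros H; apply Hno.
    exists c', m; repeat (split; [assumption|]).
    intros u Hu Hvu; apply H; now exists u. }
  assert (Hrec : forall c', valid c' -> is_interval (allowed c') ->
    stronger c' c -> exists u, extends u c' /\ forall m, visits A (ball0 N) m u).
  { intros c' Hv' HJ' Hs'.
    destruct (fusion is_interval (fun m d => forall u, extends u d ->
      visits A (ball0 N) m u) c') as (u & Hu & Hall); [|exact Hv'|exact HJ'|].
    - intros m d Hvd HJd Hsd.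
      destruct (Hvis d m Hvd HJd (stronger_trans _ _ _ Hsd Hs')) as (u & Hu & Hm).
      destruct (visits_forced A (ball0 N) m u d HA Hm Hu) as (d' & H1 & H2 & H3 & H4).
      exists d'; rewrite H2; auto.
    - exists u; split; [exact Hu|intros m].
      destruct (Hall m) as (d & _ & _ & Hd & H); auto. }
  destruct HJ as (a & b & Hab & Hc).
  set (h := ((b - a) / 3)%R).
  (* Left ends of the two outer thirds of [[a, b]]. *)
  pose (lo := fun j : nat => match j with 0 => a | _ => (a + 2 * h)%R end).
  assert (Hlo : forall j, (a <= lo j /\ lo j + h <= b)%R)
    by (intros [|j]; unfold lo, h; lra).
  pose (Q := fun e d => let w := code_nth e 1 in let j := code_nth e 0 in
    (forall u, extends u d ->
       visits A (fun z => ball0 N z /\ ~ nbhd w z) (code_nth e 2) u) \/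
    (forall u, extends u d -> ~ excludes B w (lo j) (lo j + h) u)).
  (* The interval stays fixed during this fusion, so the thirds keep their meaning at every
     stage. *)
  destruct (fusion (fun S => S = in_range a b) Q c) as (u & Hu & Hall);
    [|exact Hv|exact Hc|].
  { intros e d Hvd HJd Hsd; unfold Q.
    set (w := code_nth e 1); set (j := code_nth e 0); set (m := code_nth e 2).
    destruct (classic (exists u, extends u d /\
      visits A (fun z => ball0 N z /\ ~ nbhd w z) m u)) as [(u & Hu & Hm)|Hnv].
    { destruct (visits_forced A _ m u d HA Hm Hu) as (d' & H1 & H2 & H3 & H4).
      exists d'; rewrite H2; auto. }
    (* With no visit outside [nbhd w] possible below [d], an exclusion along [u] would persist after
       narrowing to third [j], where [Hrec] gives a sequence contradicting it. *)
    exists d; split; [exact Hvd|split; [exact HJd|]].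
    split; [now apply stronger_refl|right]; intros u Hu Hex.
    pose proof Hex as (l & i & x & Hx & Hout).
    destruct (refine_at d u l Hu) as (Hv1 & Hs1 & Ha1).
    set (d1 := Cond _ _ _) in *.
    destruct (narrow_in_range d1 a b (lo j) (lo j + h)) as (d2 & Ha2 & Hv2 & Hs2);
      [exact Hv1|exact HJd|specialize (Hlo j); unfold h in *; lra|apply Hlo|].
    assert (Hs2d : stronger d2 d) by exact (stronger_trans _ _ _ Hs2 Hs1).
    destruct (Hrec d2 Hv2) as (u2 & Hu2 & Hvis2).
    { rewrite Ha2; exists (lo j), (lo j + h)%R; split; [unfold h; lra|reflexivity]. }
    { exact (stronger_trans _ _ _ Hs2d Hsd). }
    apply (excludes_contradiction A B N w m (lo j) (lo j + h) d2 u2);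
      [exact HR|unfold h; lra|exact Ha2|exact Hu2|exact Hvis2| |].
    - intros Hm; apply Hnv; exists u2; split; [|exact Hm].
      exact (stronger_extends _ _ _ Hs2d Hu2).
    - exists l, i, x; split; [|exact Hout].
      intros u' r Hu'; apply Hx; intros s Hs.
      rewrite (Ha1 u2 (stronger_extends _ _ _ Hs2 Hu2) s Hs); auto. }
  assert (HJ : is_interval (allowed c)) by now exists a, b.
  destruct (Hred u (extends_bounded _ _ HJ Hu)) as (k & y & Hk & _ & Huniq & Hsol).
  destruct (strict_name y) as [r Hr].
  destruct (solution_excludes B a h u r) as (w & Hw & Hex);
    [exact HB|unfold h; lra| |].
  { destruct (Hsol r) as (s & v & Hs & Hd & _);
      [apply real_delta_of_error; intros m; left; apply Hr|exists s, v; auto]. }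
  (* Otherwise entries outside [nbhd w] would cluster in [[-N, N]], by uniqueness at [y], an
     interior point of [nbhd w]. *)
  assert (Hm : exists m, ~ visits A (fun z => ball0 N z /\ ~ nbhd w z) m u).
  { apply NNPP; intros H.
    destruct (infinitely_many_visits A (fun z => ball0 N z /\ ~ nbhd w z) N u k)
      as (i & Hge & HV & y' & Hy'); [exact HA|exact Hk|tauto| |].
    { intros m; apply NNPP; intros Hm; apply H; now exists m. }
    rewrite (Huniq y') in Hy' by (apply ValAdh_subseq with i; auto).
    destruct (nbhd_interior w r y Hr Hw) as (e & He & Hball).
    rewrite ValAdh_iff in Hy'; destruct (Hy' e He 0) as (n & _ & Hn).
    exact (proj2 (HV n) (Hball _ Hn)). }
  destruct Hm as [m Hm].
  assert (Hj : exists j, excludes B w (lo j) (lo j + h) u).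
  { destruct Hex as [Hex|Hex]; [now exists 0|exists 1].
    unfold lo; now replace (a + 2 * h + h)%R with (a + 3 * h)%R by ring. }
  destruct Hj as [j Hj].
  destruct (code_nth_surj 3 (fun x => match x with 0 => j | 1 => w | _ => m end))
    as [e He].
  destruct (Hall e) as (d & _ & _ & Hd & Hq); unfold Q in Hq.
  rewrite (He 0), (He 1), (He 2) in Hq by lia.
  destruct Hq as [Hq|Hq]; [exact (Hm (Hq u Hd))|exact (Hq u Hd Hj)].
Qed.

Lemma cluster_not_from_unique_cluster (A : baire -> nat -> nat -> Prop)
    (B : baire -> baire -> nat -> nat -> Prop) :
  ~ reduces_to_unique_cluster A B.
Proof.
  intros HR; pose proof HR as (HA & HB & Hred).
  destruct interval_cond as (c0 & Hv0 & HJ0).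
  destruct (fusion is_interval (fun N c => exists m, forall u, extends u c ->
    ~ visits A (ball0 N) m u) c0) as (u & Hu & Hall); [|exact Hv0|exact HJ0|].
  { intros N c Hv HJ _; destruct (avoid_ball A B N c HR Hv HJ) as (c' & m & H).
    exists c'; intuition eauto. }
  destruct (Hred u (extends_bounded _ _ HJ0 Hu)) as (k & y & Hk & Hy & _).
  (* Entries within distance 1 of [y] lie in [[-N, N]]. *)
  destruct (INR_unbounded (Rabs y + 1)) as [N HN].
  destruct (Hall N) as (c & _ & _ & Hc & m & Hm).
  apply (Hm u Hc); rewrite ValAdh_iff in Hy.
  destruct (Hy 1%R ltac:(lra) m) as (i & Hi & Hd).
  exists i, (k i); split; [exact Hi|split; [apply Hk|]].
  unfold ball0; revert HN Hd; unfold Rabs; repeat destruct Rcase_abs; lra.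
Qed.

(** * Reductions between the problems *)

Lemma eval_locally_determined (g : nat -> nat) (cK : code) (f : nat -> nat) :
  locally_determined (fun u i b => eval (const_names g u) cK (f i) b).
Proof.
  split; [intros; eapply eval_det; eauto|].
  intros u i b H; destruct (eval_use _ _ _ _ H) as [l Hl].
  exists l; intros u' Hu; apply Hl, const_names_agree, Hu.
Qed.

Lemma eval_locally_determined2 (g : nat -> nat) (cH : code) :
  locally_determined2 (fun u r j b =>
    eval (interleave (const_names g u) r) cH j b).
Proof.
  split; [intros; eapply eval_det; eauto|].
  intros u r j b H; destruct (eval_use _ _ _ _ H) as [l Hl].
  exists l; intros u' r' Hu Hr; apply Hl, interleave_agree; [|exact Hr].
  apply const_names_agree, Hu.
Qed.

(** Approximation [i] of entry [i] yields a rational sequence with the same cluster points as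
    [z]. *)
Lemma diagonal_error (k : baire) (z : nat -> R) :
  seq_delta real_space k z ->
  forall i, (Rabs (ratR (k ⟨i, i⟩) - z i) <= / 2 ^ i)%R.
Proof. intros H i; exact (real_delta_error _ _ i (H i)). Qed.

Lemma diagonal_cluster (k : baire) (z : nat -> R) (y : R) :
  seq_delta real_space k z ->
  ValAdh (fun i => ratR (k ⟨i, i⟩)) y <-> ValAdh z y.
Proof.
  intros H; pose proof (diagonal_error k z H) as He; split;
    apply ValAdh_close; intros i; [|rewrite Rabs_minus_sym]; apply He.
Qed.

Lemma diagonal_bounded (k : baire) (z : nat -> R) :
  seq_delta real_space k z -> bounded_seq z ->
  bounded_seq (fun i => ratR (k ⟨i, i⟩)).
Proof.
  intros H [M HM]; exists (M + 1)%R; intros i.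
  pose proof (diagonal_error k z H i) as He; specialize (HM i).
  pose proof (inv_pow2_le 0 i ltac:(lia)) as Hi; simpl in Hi; rewrite Rinv_1 in Hi.
  revert He HM; unfold Rabs; repeat destruct Rcase_abs; lra.
Qed.

(** [P c b] accepts [b] as entry [j0] of an answer when [c] is the recurrent value; one output entry
    thus identifies [c]. *)
Lemma not_le_BWT_R {X Y : repspace} (f : mvfun X Y) (g : nat -> nat) (j0 : nat)
    (P : nat -> nat -> Prop) :
  (forall c c' b, P c b -> P c' b -> c = c') ->
  (forall u c, only_recurrent u c -> exists x, delta (const_names g u) x /\
     dom f x /\ forall s v, delta s v -> f x v -> P c (s j0)) ->
  ~ (f ≤W BWT_R).
Proof.
  intros Pinj Hf Hle; destruct (weihrauch_le_codes _ _ Hle) as (cH & cK & Hred).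
  apply (recurrent_value_not_from_cluster _ _ P j0
    (eval_locally_determined g cK (fun i => ⟨i, i⟩))
    (eval_locally_determined2 g cH) Pinj).
  intros u c Hu; destruct (Hf u c Hu) as (x & Hx & Hdom & HP).
  destruct (Hred _ _ Hx Hdom) as (k & z & Hk & Hz & Hd & Hsol).
  apply dom_BWT_R in Hd.
  exists (fun i => k ⟨i, i⟩); split; [auto|split].
  - exact (diagonal_bounded _ _ Hz Hd).
  - intros y r Hy Hr; apply (diagonal_cluster _ _ _ Hz) in Hy.
    destruct (Hsol y r (conj Hd Hy) Hr) as (s & v & Hs & Hsv & Hv).
    exists (s j0); split; [apply Hs|exact (HP s v Hsv Hv)].
Qed.

Lemma CL_N_not_le_BWT_R : ~ (CL_N ≤W BWT_R).
Proof.
  apply (not_le_BWT_R CL_N (fun n => n) 0 (fun c b => b = c)); [congruence|].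
  intros u c [Hc Hother]; exists u; split; [|split].
  - intros i; simpl; apply const_names_eq.
  - exists c; exact Hc.
  - intros s v Hs Hv; simpl in Hs; rewrite Hs.
    apply NNPP; intros Hne; destruct (Hother v Hne) as [N HN].
    destruct (Hv N) as (k & Hk & Heq); exact (HN k Hk Heq).
Qed.

Lemma ratR_INR (n : nat) : ratR ⟨⟨n, 0⟩, 0⟩ = INR n.
Proof.
  unfold ratR, rat; rewrite !Cantor.cancel_of_to; unfold Q2R; simpl.
  rewrite Z.sub_0_r, INR_IZR_INZ; field.
Qed.

Lemma INR_close (m n : nat) : (Rabs (INR m - INR n) < 1)%R -> m = n.
Proof.
  intros H; destruct (Nat.lt_trichotomy m n) as [Hl|[Hl|Hl]]; [|exact Hl|];
    apply le_INR in Hl; rewrite S_INR in Hl;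
    revert H; unfold Rabs; destruct Rcase_abs; lra.
Qed.

Lemma only_recurrent_cluster (u : baire) (c : nat) :
  only_recurrent u c -> UCL_R (fun s => INR (u s)) (INR c).
Proof.
  intros [Hc Hother]; split.
  - apply ValAdh_iff; intros eps He N; destruct (Hc N) as (s & Hs & Heq).
    exists s; split; [exact Hs|]; now rewrite Heq, Rminus_diag, Rabs_R0.
  - intros z Hz; rewrite ValAdh_iff in Hz.
    destruct (Hz (/ 2)%R ltac:(lra) 0) as (s0 & _ & Hs0).
    assert (Hconst : forall s, (Rabs (INR (u s) - z) < / 2)%R -> u s = u s0).
    { intros s Hs; apply INR_close.
      revert Hs Hs0; unfold Rabs; repeat destruct Rcase_abs; lra. }
    (* All terms within 1/2 of [z] share one value, which recurs and is therefore [c]. *)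
    assert (Heq : u s0 = c).
    { apply NNPP; intros Hne; destruct (Hother _ Hne) as [N HN].
      destruct (Hz (/ 2)%R ltac:(lra) N) as (s & Hs & Hd).
      exact (HN s Hs (Hconst s Hd)). }
    apply NNPP; intros Hne.
    assert (Hpos : (0 < Rabs (INR c - z))%R) by (apply Rabs_pos_lt; lra).
    destruct (Hz (Rmin (/ 2) (Rabs (INR c - z))) ltac:(apply Rmin_pos; lra) 0)
      as (s & _ & Hs).
    assert (Hs2 : (Rabs (INR (u s) - z) < / 2)%R)
      by (eapply Rlt_le_trans; [exact Hs|apply Rmin_l]).
    rewrite (Hconst s Hs2), Heq in Hs.
    pose proof (Rmin_r (/ 2) (Rabs (INR c - z))); lra.
Qed.

Lemma UCL_R_not_le_BWT_R : ~ (UCL_R ≤W BWT_R).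
Proof.
  (* Entry 2 of a name has error at most 1/4, enough to identify a natural number. *)
  apply (not_le_BWT_R UCL_R (fun n => ⟨⟨n, 0⟩, 0⟩) 2
    (fun c b => (Rabs (ratR b - INR c) < / 2)%R)).
  - intros c c' b H H'; apply INR_close.
    revert H H'; unfold Rabs; repeat destruct Rcase_abs; lra.
  - intros u c Hu; exists (fun s => INR (u s)); split; [|split].
    + intros i.
      replace (fun j => const_names (fun n => ⟨⟨n, 0⟩, 0⟩) u ⟨i, j⟩)
        with (fun _ : nat => ⟨⟨u i, 0⟩, 0⟩).
      * rewrite <- ratR_INR; apply real_delta_const.
      * apply functional_extensionality; intros j; now rewrite const_names_eq.
    + exists (INR c); now apply only_recurrent_cluster.
    + intros s v Hs [Hv _].
      rewrite (proj2 (only_recurrent_cluster u c Hu) v Hv) in Hs.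
      pose proof (real_delta_error s _ 2 Hs) as H; simpl in H; lra.
Qed.

Lemma const_names_rational (u : baire) :
  seq_delta real_space (const_names (fun n => n) u) (fun s => ratR (u s)).
Proof.
  intros i; replace (fun j => const_names (fun n => n) u ⟨i, j⟩)
    with (fun _ : nat => u i).
  - apply real_delta_const.
  - apply functional_extensionality; intros j; now rewrite const_names_eq.
Qed.

Lemma BWT_R_not_le_UCL_R : ~ (BWT_R ≤W UCL_R).
Proof.
  intros Hle; destruct (weihrauch_le_codes _ _ Hle) as (cH & cK & Hred).
  eapply cluster_not_from_unique_cluster.
  split; [exact (eval_locally_determined (fun n => n) cK (fun i => ⟨i, i⟩))|].
  split; [exact (eval_locally_determined2 (fun n => n) cH)|intros u Hu].
  destruct (Hred _ _ (const_names_rational u) (proj2 (dom_BWT_R _) Hu))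
    as (k & z & Hk & Hz & [y [Hy Huniq]] & Hsol).
  exists (fun i => k ⟨i, i⟩), y; split; [auto|split; [|split]].
  - now apply (diagonal_cluster _ _ _ Hz).
  - intros z' Hz'; apply Huniq; now apply (diagonal_cluster _ _ _ Hz).
  - intros r Hr; destruct (Hsol y r (conj Hy Huniq) Hr) as (s & v & Hs & Hd & Hv).
    exists s, v; split; [exact Hs|split; [exact Hd|apply Hv]].
Qed.

Lemma BWT_R_not_le_CL_N : ~ (BWT_R ≤W CL_N).
Proof.
  intros Hle; destruct (weihrauch_le_codes _ _ Hle) as (cH & cK & Hred).
  (* Each inner solution [n] has a constant name, so there is one candidate computation per natural
     number. *)
  apply (cluster_not_countably_determined (fun n u j b =>
    eval (interleave (const_names (fun n => n) u) (fun _ => n)) cH j b)).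
  { intros n; destruct (eval_locally_determined2 (fun n => n) cH) as [Hdet Hloc].
    split; [intros u; apply Hdet|].
    intros u j b Hb; destruct (Hloc _ _ _ _ Hb) as [l Hl].
    exists l; intros u' Hu; apply Hl; [exact Hu|intros m Hm; reflexivity]. }
  intros u Hu.
  destruct (Hred _ _ (const_names_rational u) (proj2 (dom_BWT_R _) Hu))
    as (k & z & _ & _ & [n Hn] & Hsol).
  destruct (Hsol n (fun _ => n) Hn eq_refl) as (s & v & Hs & Hd & Hv).
  exists n, s, v; split; [exact Hs|split; [exact Hd|apply Hv]].
Qed.

Theorem theorem12p4 :
  ~ (UCL_R ≤W BWT_R) /\ ~ (BWT_R ≤W UCL_R) /\
  ~ (CL_N ≤W BWT_R) /\ ~ (BWT_R ≤W CL_N).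
Proof.
  split; [exact UCL_R_not_le_BWT_R|split; [exact BWT_R_not_le_UCL_R|]].
  split; [exact CL_N_not_le_BWT_R|exact BWT_R_not_le_CL_N].
Qed.
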